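(* Let $\Lambda,\mu,R>0$, $\rho=\Lambda/\mu$, and $C_1,C_2\ge0$ with $\max\{C_1,C_2\}>0$. In the unobservable infinite-server queue, let $\widetilde q$ be the optimal joining probability of revenue (the maximizer of $S(q)$ over $q\in[0,1]$) and $\widetilde P_u$ the corresponding optimal entrance price. Then the following hold. (a) If $R\ge 2\rho C_1+3\rho^2C_2$, then $\widetilde q=1$, $S(\widetilde q)=\mu(R\rho-C_1\rho^2-C_2\rho^3)$, and $\widetilde P_u=R-C_1\rho-C_2\rho^2$. (b) If $R<2\rho C_1+3\rho^2C_2$, then $$\widetilde q=\frac{-C_1+\sqrt{C_1^2+3RC_2}}{3C_2\rho},$$ $$S(\widetilde q)=\frac{-2C_1^3-9RC_1C_2+(2C_1^2+6RC_2)\sqrt{C_1^2+3RC_2}}{27C_2^2}\,\mu,$$ $$\widetilde P_u=\frac{6RC_2+C_1^2-C_1\sqrt{C_1^2+3RC_2}}{9C_2},$$ where for $C_2=0$ these expressions are read as their limits as $C_2\to0^+$, namely $\frac{R}{2C_1\rho}$, $\frac{\mu R^2}{4C_1}$ and $\frac R2$.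
   Context: Unobservable infinite-server queue: customers arrive in a Poisson process of rate $\Lambda$, sojourn times are i.i.d. with mean $1/\mu$, $\rho=\Lambda/\mu$, and customers do not observe the number of customers present. If every customer joins with probability $q\in[0,1]$, the expected number in system is $\mathbb{E}(L)=\rho q$ and the utility of a joining customer before any fee is $R-(C_1\rho q+C_2(\rho q)^2)$. The maximum entrance price that supports joining probability $q$ is $P_u=R-[C_1\rho q+C_2(\rho q)^2]$, and the revenue (equal to social welfare) per time unit is $$S(q)=q\Lambda\bigl[R-(C_1\rho q+C_2(\rho q)^2)\bigr].$$ The optimal entrance price is $\widetilde P_u=R-[C_1\rho\widetilde q+C_2(\rho\widetilde q)^2]$. *)

(* Defs.v *)
From HB Require Import structures.
From mathcomp Require Import all_boot all_order all_algebra.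
From mathcomp Require Import all_classical all_reals all_analysis.
Set Implicit Arguments.
Unset Strict Implicit.
Unset Printing Implicit Defensive.
Import Order.TTheory GRing.Theory Num.Theory.
Import numFieldNormedType.Exports.
Local Open Scope classical_set_scope.
Local Open Scope ring_scope.

(* Unobservable infinite-server queue: arrival rate [Lambda], mean sojourn
   time [mu^-1], value of service [R]; a customer who meets (in expectation)
   [x] customers in the system incurs the cost [C1 * x + C2 * x ^+ 2].
   The ground field is called [K], since [R] is the value of service. *)

Definition load (K : realType) (Lambda mu : K) : K := Lambda / mu.

(* E(L) when every customer joins with probability [q]: by Little's law, the
   effective arrival rate [q * Lambda] times the mean sojourn time. *)
Definition mean_number (K : realType) (Lambda mu q : K) : K :=
  load Lambda mu * q.

(* The price [P_u] that leaves a joining customer with zero net utility. *)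
Definition entrance_price (K : realType) (Lambda mu R C1 C2 q : K) : K :=
  R - (C1 * mean_number Lambda mu q + C2 * mean_number Lambda mu q ^+ 2).

(* S(q), per time unit: it is both the server's revenue and social welfare. *)
Definition revenue (K : realType) (Lambda mu R C1 C2 q : K) : K :=
  q * Lambda * entrance_price Lambda mu R C1 C2 q.

Definition optimal_joining (K : realType) (Lambda mu R C1 C2 q : K) : Prop :=
  q \in `[0, 1] /\
  forall q' : K, q' \in `[0, 1] ->
    revenue Lambda mu R C1 C2 q' <= revenue Lambda mu R C1 C2 q.

(* Closed forms for an interior optimum.  They are meaningful for [C2 != 0]
   only: at [C2 = 0] the library's convention for division by zero makes them
   0, so there they have to be replaced by their limits as [C2] tends to 0
   from the right. *)

Definition interior_joining (K : realType) (rho R C1 C2 : K) : K :=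
  (- C1 + Num.sqrt (C1 ^+ 2 + 3 * R * C2)) / (3 * C2 * rho).

Definition interior_revenue (K : realType) (mu R C1 C2 : K) : K :=
  (- 2 * C1 ^+ 3 - 9 * R * C1 * C2
   + (2 * C1 ^+ 2 + 6 * R * C2) * Num.sqrt (C1 ^+ 2 + 3 * R * C2))
  / (27 * C2 ^+ 2) * mu.

Definition interior_price (K : realType) (R C1 C2 : K) : K :=
  (6 * R * C2 + C1 ^+ 2 - C1 * Num.sqrt (C1 ^+ 2 + 3 * R * C2)) / (9 * C2).

(* Main.v *)
Require Import Defs.
From HB Require Import structures.
From mathcomp Require Import all_boot all_order all_algebra.
From mathcomp Require Import all_classical all_reals all_analysis.
From mathcomp Require Import ring lra.
Set Implicit Arguments.
Unset Strict Implicit.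
Unset Printing Implicit Defensive.
Import Order.TTheory GRing.Theory Num.Theory.
Import numFieldNormedType.Exports.
Local Open Scope classical_set_scope.
Local Open Scope ring_scope.

(** In terms of the load [x = rho * q] the revenue is [mu * f x] with
    [f x = x * (R - C1 * x - C2 * x ^+ 2)], a strictly concave function of
    [x >= 0].  Everything about the maximizer comes from one exact Taylor
    identity at a load [y] ([revenue_sub]):

      [f y - f x = (y - x) * f' y + (y - x) ^+ 2 * (C1 + C2 * (2 * y + x))].

    The quadratic coefficient is positive, so [y] in [0, rho] is the only
    maximizer as soon as [(y - x) * f' y >= 0] for every admissible [x]
    ([optimal_joining_unique]).  That holds at [y = rho] if [f' rho >= 0], which
    is regime (a), and at the positive root [x0] of [f'] if [x0 <= rho], which
    is regime (b).

    The closed forms of regime (b) divide by [C2].  Rationalizing the root as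
    [x0 = R / (C1 + sqrt (C1 ^+ 2 + 3 * R * C2))] removes the singularity:
    this load is stationary for [C2 = 0] as well, and it is continuous in [C2].
    Since [f' x0 = 0] reads [3 * C2 * x0 ^+ 2 = R - 2 * C1 * x0], the optimal
    price is [(2 * R - C1 * x0) / 3], again without division by [C2].  Hence
    the optimum is described uniformly in [C2 >= 0], and both the formulas for
    [C2 > 0] and the limits as [C2] tends to 0 are read off from [x0]. *)

(** [f' x], the derivative of the revenue per unit of [mu] in the load [x]. *)
Definition marginal (K : realType) (R C1 C2 x : K) : K :=
  R - 2 * C1 * x - 3 * C2 * x ^+ 2.

(** The positive root of [marginal], written with the conjugate
    [C1 + sqrt _] in the denominator so that it also makes sense at
    [C2 = 0]. *)
Definition stationary_load (K : realType) (R C1 C2 : K) : K :=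
  R / (C1 + Num.sqrt (C1 ^+ 2 + 3 * R * C2)).

Lemma max_gt0_add (K : realDomainType) (a b : K) :
  0 <= a -> 0 <= b -> 0 < Num.max a b -> 0 < a + b.
Proof. by rewrite lt_max => a0 b0 /orP[] ?; lra. Qed.

(** * Maximizers of the revenue *)

(** The remainder of this second-order expansion is exact because the revenue
    is a cubic polynomial; its sign is visible when [q] and [q'] are
    nonnegative. *)
Lemma revenue_sub (K : realType) (Lambda mu R C1 C2 q q' : K) :
  mu != 0 ->
  let y := load Lambda mu * q in
  let x := load Lambda mu * q' in
  revenue Lambda mu R C1 C2 q - revenue Lambda mu R C1 C2 q' =
  mu * ((y - x) * marginal R C1 C2 y
        + (y - x) ^+ 2 * (C1 + C2 * (2 * y + x))).
Proof.
move=> mu0 /=.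
rewrite /revenue /entrance_price /mean_number /marginal /load.
by field.
Qed.

(** The sign condition is the first-order condition for a maximum on an
    interval; concavity makes it sufficient and the maximizer unique. *)
Lemma optimal_joining_unique (K : realType) (Lambda mu R C1 C2 q : K) :
  0 < Lambda -> 0 < mu -> 0 <= C1 -> 0 <= C2 -> 0 < C1 + C2 ->
  0 < q -> q <= 1 ->
  (forall q', 0 <= q' <= 1 ->
    0 <= (q - q') * marginal R C1 C2 (load Lambda mu * q)) ->
  forall p, optimal_joining Lambda mu R C1 C2 p <-> p = q.
Proof.
move=> L0 mu0 C10 C20 C0 q0 q1 Hq.
have r0 : 0 < load Lambda mu by exact: divr_gt0.
have coef_gt0 q' : 0 <= q' ->
    0 < C1 + C2 * (2 * (load Lambda mu * q) + load Lambda mu * q').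
  move=> q'0.
  have y0 : 0 < load Lambda mu * q by exact: mulr_gt0.
  have x0 : 0 <= load Lambda mu * q' by rewrite mulr_ge0// ltW.
  have [C1p|C1n] := ltP 0 C1; first by rewrite ltr_wpDr// mulr_ge0//; lra.
  by rewrite ltr_wpDl// mulr_gt0//; lra.
have gap q' : 0 <= q' <= 1 ->
    mu * ((load Lambda mu * (q - q')) ^+ 2
          * (C1 + C2 * (2 * (load Lambda mu * q) + load Lambda mu * q')))
    <= revenue Lambda mu R C1 C2 q - revenue Lambda mu R C1 C2 q'.
  move=> q'01; rewrite revenue_sub ?gt_eqF// -mulrBr.
  by rewrite ler_pM2l// lerDr -mulrA mulr_ge0 ?Hq// ltW.
have qI : q \in `[0, 1] by rewrite in_itv/= (ltW q0) q1.
move=> p; split=> [[pI pmax]|->]; last first.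
  split=> // q'; rewrite in_itv/= => q'01.
  rewrite -subr_ge0; apply: le_trans (gap _ q'01).
  rewrite mulr_ge0 ?(ltW mu0)// mulr_ge0 ?sqr_ge0//.
  by rewrite ltW// coef_gt0//; lra.
move: pI; rewrite in_itv/= => p01.
apply/eqP/negPn/negP => pq.
have := gap _ p01.
have := pmax _ qI; rewrite -subr_le0 => le0 /le_trans /(_ le0).
rewrite leNgt mulr_gt0// mulr_gt0 ?coef_gt0//; last by lra.
by rewrite exprn_even_gt0//= mulf_neq0 ?(gt_eqF r0)// subr_eq0 eq_sym.
Qed.

(** * The stationary load *)

Section StationaryLoad.
Variables (K : realType) (R C1 C2 : K).
Hypotheses (R_gt0 : 0 < R) (C1_ge0 : 0 <= C1) (C2_ge0 : 0 <= C2).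
Hypothesis C_gt0 : 0 < C1 + C2.

Let s : K := Num.sqrt (C1 ^+ 2 + 3 * R * C2).

Let s_sqr : s ^+ 2 = C1 ^+ 2 + 3 * R * C2.
Proof. by rewrite sqr_sqrtr// addr_ge0 ?sqr_ge0// !mulr_ge0// ltW. Qed.

Let denominator_gt0 : 0 < C1 + s.
Proof.
have [C1p|C1n] := ltP 0 C1; first by rewrite ltr_wpDr// sqrtr_ge0.
rewrite ltr_wpDl// sqrtr_gt0 ltr_wpDl ?sqr_ge0// !mulr_gt0//.
by rewrite (lt_le_trans C_gt0)// gerDr.
Qed.

Lemma stationary_load_gt0 : 0 < stationary_load R C1 C2.
Proof. exact: divr_gt0. Qed.

Lemma marginal_stationary_load :
  marginal R C1 C2 (stationary_load R C1 C2) = 0.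
Proof.
rewrite /marginal /stationary_load -/s.
have d0 : C1 + s != 0 by rewrite gt_eqF.
have -> : R - 2 * C1 * (R / (C1 + s)) - 3 * C2 * (R / (C1 + s)) ^+ 2
    = R * (s ^+ 2 - (C1 ^+ 2 + 3 * R * C2)) / (C1 + s) ^+ 2.
  by field.
by rewrite s_sqr subrr mulr0 mul0r.
Qed.

(** The marginal revenue decreases in the load, so its root lies below any
    load at which it is negative. *)
Lemma stationary_load_lt (x : K) :
  0 <= x -> marginal R C1 C2 x < 0 -> stationary_load R C1 C2 < x.
Proof.
move=> x0; apply: contraTT; rewrite -!leNgt => xs.
rewrite -marginal_stationary_load /marginal.
rewrite lerB//; first by rewrite lerB// ler_wpM2l// mulr_ge0.
by rewrite ler_wpM2l ?mulr_ge0// lerXn2r// nnegrE// (le_trans x0).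
Qed.

(** Eliminating [C2] by means of [marginal _ _ _ _ = 0]. *)
Lemma price_stationary_load :
  let x := stationary_load R C1 C2 in
  R - (C1 * x + C2 * x ^+ 2) = (2 * R - C1 * x) / 3.
Proof.
by move=> x; have := marginal_stationary_load; rewrite /marginal -/x; lra.
Qed.

(** [C1 + s] and [- C1 + s] are conjugate: their product is [3 * R * C2]. *)
Lemma stationary_loadE : 0 < C2 ->
  stationary_load R C1 C2 = (s - C1) / (3 * C2).
Proof.
move=> C2p; rewrite /stationary_load -/s.
have d0 : C1 + s != 0 by rewrite gt_eqF.
have C20 : 3 * C2 != 0 by rewrite gt_eqF ?mulr_gt0.
apply/eqP; rewrite eqr_div//.
by apply/eqP; transitivity (s ^+ 2 - C1 ^+ 2); [rewrite s_sqr|]; ring.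
Qed.

Lemma interior_joiningE (rho : K) : 0 < C2 -> rho != 0 ->
  interior_joining rho R C1 C2 = stationary_load R C1 C2 / rho.
Proof.
move=> C2p rho0; rewrite stationary_loadE// /interior_joining -/s.
by field; rewrite rho0 gt_eqF.
Qed.

Lemma interior_priceE : 0 < C2 ->
  interior_price R C1 C2 = (2 * R - C1 * stationary_load R C1 C2) / 3.
Proof.
move=> C2p; rewrite stationary_loadE// /interior_price -/s.
by field; rewrite gt_eqF.
Qed.

Lemma interior_revenueE (mu : K) : 0 < C2 ->
  interior_revenue mu R C1 C2 =
  mu * stationary_load R C1 C2
  * ((2 * R - C1 * stationary_load R C1 C2) / 3).
Proof.
move=> C2p; rewrite stationary_loadE// /interior_revenue -/s.
have C20 : C2 != 0 by rewrite gt_eqF.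
(* The product on the right contains [s ^+ 2]; the closed form does not. *)
have -> : mu * ((s - C1) / (3 * C2)) * ((2 * R - C1 * ((s - C1) / (3 * C2))) / 3)
    = mu * (6 * R * C2 * (s - C1) - C1 * (s ^+ 2 - 2 * C1 * s + C1 ^+ 2))
      / (27 * C2 ^+ 2).
  by field.
by rewrite s_sqr; field.
Qed.

End StationaryLoad.

(** * The limit of vanishing quadratic cost *)

Lemma stationary_load0 (K : realType) (R C1 : K) :
  0 <= C1 -> stationary_load R C1 0 = R / (2 * C1).
Proof.
move=> C10.
by rewrite /stationary_load mulr0 addr0 sqrtr_sqr ger0_norm// mulr_natl mulr2n.
Qed.

(** The conjugate form has no singularity at 0, hence plain continuity. *)
Lemma cvg_stationary_load (K : realType) (R C1 : K) : 0 < C1 ->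
  stationary_load R C1 c @[c --> 0^'+] --> R / (2 * C1).
Proof.
move=> C1p; rewrite -(stationary_load0 _ (ltW C1p)).
apply: cvg_at_right_filter; apply: cvgM; first exact: cvg_cst.
apply: cvgV.
  by rewrite gt_eqF// ltr_wpDr// sqrtr_ge0.
apply: cvgD; first exact: cvg_cst.
apply: (@continuous_comp _ _ _ (fun c => C1 ^+ 2 + 3 * R * c)); last first.
  exact: sqrt_continuous.
apply: cvgD; first exact: cvg_cst.
by apply: cvgM; [exact: cvg_cst|exact: cvg_id].
Qed.

Lemma cvg_at_right_eq (K : realType) (a l : K) (f g : K -> K) :
  (forall x, a < x -> f x = g x) ->
  g x @[x --> a^'+] --> l -> f x @[x --> a^'+] --> l.
Proof.
move=> fg; apply: cvg_trans; apply: near_eq_cvg; near=> x.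
by rewrite fg//; near: x; exact: nbhs_right_gt.
Unshelve. all: by end_near. Qed.

Lemma cvg_interior (K : realType) (mu rho R C1 : K) :
  0 < rho -> 0 < R -> 0 < C1 ->
  [/\ interior_joining rho R C1 c @[c --> 0^'+] --> R / (2 * C1 * rho),
      interior_revenue mu R C1 c @[c --> 0^'+] --> mu * R ^+ 2 / (4 * C1)
    & interior_price R C1 c @[c --> 0^'+] --> R / 2].
Proof.
move=> rho0 R0 C10.
have C1n : C1 != 0 by rewrite gt_eqF.
have rhon : rho != 0 by rewrite gt_eqF.
have cvgx := @cvg_stationary_load K R C1 C10.
have cvgP : (2 * R - C1 * stationary_load R C1 c) / 3 @[c --> 0^'+] --> R / 2.
  have -> : R / 2 = (2 * R - C1 * (R / (2 * C1))) / 3 by field.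
  apply: cvgM; last exact: cvg_cst.
  apply: cvgB; first exact: cvg_cst.
  by apply: cvgM; first exact: cvg_cst.
have C0 c : 0 < c -> 0 < C1 + c by move=> ?; exact: addr_gt0.
split.
- apply: (@cvg_at_right_eq _ _ _ _ (fun c => stationary_load R C1 c / rho)).
    by move=> c c0; apply: interior_joiningE => //; rewrite ?ltW// C0.
  have -> : R / (2 * C1 * rho) = R / (2 * C1) / rho by field; rewrite rhon.
  by apply: cvgM => //; exact: cvg_cst.
- apply: (@cvg_at_right_eq _ _ _ _ (fun c => mu * stationary_load R C1 c
      * ((2 * R - C1 * stationary_load R C1 c) / 3))).
    by move=> c c0; apply: interior_revenueE => //; rewrite ?ltW// C0.
  have -> : mu * R ^+ 2 / (4 * C1) = mu * (R / (2 * C1)) * (R / 2) by field.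
  by apply: cvgM => //; apply: cvgM => //; exact: cvg_cst.
- apply: cvg_at_right_eq cvgP => c c0.
  by apply: interior_priceE => //; rewrite ?ltW// C0.
Qed.

(** * The optimal joining probability *)

Theorem theorem6 (K : realType) (Lambda mu R C1 C2 : K)
    (Lambda_gt0 : 0 < Lambda) (mu_gt0 : 0 < mu) (R_gt0 : 0 < R)
    (C1_ge0 : 0 <= C1) (C2_ge0 : 0 <= C2) (maxC_gt0 : 0 < Num.max C1 C2) :
  let rho := load Lambda mu in
  let S := revenue Lambda mu R C1 C2 in
  let Pu := entrance_price Lambda mu R C1 C2 in
  (exists! q : K, optimal_joining Lambda mu R C1 C2 q) /\
  forall qt : K, optimal_joining Lambda mu R C1 C2 qt ->
    (2 * rho * C1 + 3 * rho ^+ 2 * C2 <= R ->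
      [/\ qt = 1,
          S qt = mu * (R * rho - C1 * rho ^+ 2 - C2 * rho ^+ 3)
        & Pu qt = R - C1 * rho - C2 * rho ^+ 2]) /\
    (R < 2 * rho * C1 + 3 * rho ^+ 2 * C2 ->
      (0 < C2 ->
        [/\ qt = interior_joining rho R C1 C2,
            S qt = interior_revenue mu R C1 C2
          & Pu qt = interior_price R C1 C2]) /\
      (C2 = 0 ->
        [/\ interior_joining rho R C1 c @[c --> 0^'+] --> R / (2 * C1 * rho),
            interior_revenue mu R C1 c @[c --> 0^'+] --> mu * R ^+ 2 / (4 * C1)
          & interior_price R C1 c @[c --> 0^'+] --> R / 2] /\
        [/\ qt = R / (2 * C1 * rho),
            S qt = mu * R ^+ 2 / (4 * C1)
          & Pu qt = R / 2])).
Proof.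
move=> rho S Pu.
have C_gt0 : 0 < C1 + C2 by exact: max_gt0_add.
have rho_gt0 : 0 < rho by exact: divr_gt0.
have rho_neq0 : rho != 0 by rewrite gt_eqF.
have Lambda_rho : Lambda = mu * rho.
  by rewrite /rho /load mulrC divfK// gt_eqF.
have [highR|lowR] := leP (2 * rho * C1 + 3 * rho ^+ 2 * C2) R.
- have opt1 : forall p, optimal_joining Lambda mu R C1 C2 p <-> p = 1.
    apply: optimal_joining_unique => // q' /andP[_ q'1].
    rewrite mulr1 -/rho mulr_ge0 ?subr_ge0// /marginal; lra.
  split; first by exists 1; split=> [|p /opt1//]; exact/opt1.
  move=> qt /opt1 ->; split=> // _.
  rewrite /S /Pu /revenue /entrance_price /mean_number -/rho Lambda_rho.
  by split=> //; ring.
set x := stationary_load R C1 C2.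
have x_gt0 : 0 < x by exact: stationary_load_gt0.
have x_lt : x < rho.
  by apply: stationary_load_lt => //; rewrite ?ltW// /marginal; lra.
have xE : rho * (x / rho) = x by rewrite mulrC divfK.
have optx : forall p, optimal_joining Lambda mu R C1 C2 p <-> p = x / rho.
  apply: optimal_joining_unique => //; first exact: divr_gt0.
    by rewrite ler_pdivrMr// mul1r ltW.
  by move=> q' _; rewrite -/rho xE marginal_stationary_load// mulr0.
split; first by exists (x / rho); split=> [|p /optx//]; exact/optx.
move=> qt /optx qtE; split=> // _.
have PuE : Pu qt = (2 * R - C1 * x) / 3.
  by rewrite qtE /Pu /entrance_price /mean_number -/rho xE price_stationary_load.
have SE : S qt = mu * x * ((2 * R - C1 * x) / 3).
  rewrite /S /revenue -/(Pu qt) PuE qtE Lambda_rho.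
  by congr (_ * _); field.
split=> [C2_gt0|C2E].
  by rewrite SE PuE qtE interior_joiningE// interior_revenueE// interior_priceE.
have C1_gt0 : 0 < C1 by move: C_gt0; rewrite C2E addr0.
have C1_neq0 : C1 != 0 by rewrite gt_eqF.
split; first exact: cvg_interior.
have x0E : x = R / (2 * C1) by rewrite /x C2E stationary_load0.
rewrite SE PuE qtE x0E.
by split; field; rewrite ?rho_neq0.
Qed.
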